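(* Let $(N,R)$ be an instance of the minimum Steiner tree problem, where $N=(V,E,\sigma)$, and let $r\in R$ be a root. Then the $\mathrm{DS}^*$ algorithm (described in the context), run on $(N,R)$, $r$ and a Steiner heuristic function $h^*$, terminates if $h^*$ is admissible. Further, after termination, $l(r,R\setminus\{r\})$ is the cost of a Steiner minimal tree for the instance $(N,R)$, i.e., $l(r,R\setminus\{r\})=l^*(r,R\setminus\{r\})=\mathrm{csmt}(N,R)$.
   Context: A network is $N=(V,E,\sigma)$ where $(V,E)$ is a connected undirected graph and $\sigma:E\to\{1,2,3,\dots\}$ gives edge costs; $d_N(x,y)$ is the length of a shortest path between $x$ and $y$ in $N$. An instance of the minimum Steiner tree problem is a pair $(N,R)$ with $\emptyset\ne R\subseteq V$ (the terminals). A Steiner tree for $(N,R)$ is a tree $(V',E')$, rooted at some terminal, with $R\subseteq V'\subseteq V$ and $E'\subseteq E$; its cost is $\sum_{e\in E'}\sigma(e)$. A Steiner minimal tree (SMT) is a Steiner tree of minimum cost, and $\mathrm{csmt}(N,R)$ is that cost. For $u\in V$, $I\subseteq R$, put $l^*(u,I):=\mathrm{csmt}(N,I\cup\{u\})$. A Steiner heuristic function is a map $h^*$ from $V\times 2^R$ to the non-negative integers. It is admissible if $h^*(u,I)\le l^*(u,I)$ for every $u\in V$ and every $I$ with $\{r\}\subseteq I\subseteq R$. The $\mathrm{DS}^*$ algorithm. Let $R'=R\setminus\{r\}$. The symbol $\infty$ abbreviates $\sum_{e\in E}\sigma(e)$. Initialization: $l(u,I)\gets\infty$ for all $(u,I)\in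 V\times 2^{R'}$; $l(u,\{u\})\gets 0$ for all $u\in R'$; $l(u,\emptyset)\gets0$ for all $u\in V$; $b(u,I)\gets\emptyset$ for all $(u,I)\in V\times 2^{R'}$; $Q\gets\{(u,\{u\}): u\in R'\}$; $P\gets\emptyset$. Main loop: while $(r,R')\notin P$, do the following. 1. Choose $(u,I)\in Q$ minimizing $l(u,I)+h^*(u,R\setminus I)$; set $Q\gets Q\setminus\{(u,I)\}$ and $P\gets P\cup\{(u,I)\}$. 2. For each $J$ with $\emptyset\subsetneq J\subseteq R'\setminus I$ and $(u,J)\in P$: if $l(u,I)+l(u,J)<l(u,I\cup J)$, then set $l(u,I\cup J)\gets l(u,I)+l(u,J)$ and $b(u,I\cup J)\gets\{(u,I),(u,J)\}$, and, if not $\mathit{prune\_combine}(u,I,J)$, set $Q\gets Q\cup\{(u,I\cup J)\}$. 3. For each edge $\{u,v\}\in E$ incident to $u$: if $l(u,I)+\sigma(\{u,v\})<l(v,I)$, then set $l(v,I)\gets l(u,I)+\sigma(\{u,v\})$ and $b(v,I)\gets\{(u,I)\}$, and, if not $\mathit{prune}(u,I)$, set $Q\gets Q\cup\{(v,I)\}$. Output: the tree with edge set $\mathrm{retraceSMT}(r,R')$ and root $r$, together with $l(r,R')$, where $\mathrm{retraceSMT}(u,I):=\bigcup_{(u',I')\in b(u,I)}\bigl(\mathrm{retraceSMT}(u',I')\cup\{\{u,u'\}: u\ne u'\}\bigr)$. Pruning. For sets $J$ of terminals an upper bound $U(J)$ and a set $S(J)$ are maintained. For $A,B\subseteq V$ let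 $sd(A,B):=\min_{x\in A,\,y\in B}d_N(x,y)$. A call $\mathit{prune}(v,J)$ updates $U(J)\gets\min\{U(J),\ l(v,J)+\min\{sd(J,R\setminus J),\,sd(\{v\},R\setminus J)\}\}$; if this changes $U(J)$, then $S(J)\gets\{z\}$, where $z\in R\setminus J$ is the terminal attaining the minimum in the $sd$ terms. The pruning functions return true whenever the tentative cost $l(v,J)$ exceeds $U(J)$. The call $\mathit{prune\_combine}(u,J_1,J_2)$ first checks whether $U(J_1)$ and $U(J_2)$ are defined; if so, and if $S(J_1)\cap J_2=\emptyset$ or $S(J_2)\cap J_1=\emptyset$, it sets $U(J_1\cup J_2)\gets U(J_1)+U(J_2)$ and $S(J_1\cup J_2)\gets(S(J_1)\cup S(J_2))\setminus(J_1\cup J_2)$. It then proceeds as $\mathit{prune}$ does, for the tuple $(u,J_1\cup J_2)$.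
   Formalization: If R={r} or csmt(N,R) equals ∞ (the sum of all edge costs), Q runs empty and (r,R') never enters P; termination there means stopping with Q empty. Otherwise every run ends with (r,R') in P. The value l(r,R') is correct in all cases. *)

(* Defs.v *)
From Stdlib Require Import Relation_Operators.
From mathcomp Require Import all_boot.

Set Implicit Arguments.
Unset Strict Implicit.
Unset Printing Implicit Defensive.

(* The value returned on an empty range is 0; on a nonempty one the neutral
   element is an upper bound of all values, so this is the least value
   (see min_overP). *)
Definition min_over (T : finType) (A : pred T) (F : T -> nat) : nat :=
  \big[minn / \max_(x | A x) F x]_(x | A x) F x.

Lemma min_overP (T : finType) (A : pred T) (F : T -> nat) (x0 : T) :
  A x0 -> (exists2 x, A x & F x = min_over A F) /\
          (forall y, A y -> min_over A F <= F y).
Proof.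
move=> Ax0; have lb y : A y -> min_over A F <= F y.
  move=> Ay; rewrite /min_over; move: (\max_(x | A x) F x) => m.
  have := mem_index_enum y.
  elim: (index_enum T) => // z e IHe; rewrite inE big_cons.
  case/predU1P => [<- | /IHe le_e]; first by rewrite Ay geq_minl.
  by case: ifP => // _; rewrite geq_min le_e orbT.
split=> //.
have [x1 Ax1 Fx1] : {x1 | A x1 & \max_(x | A x) F x = F x1}.
  by apply: eq_bigmax_cond; apply/card_gt0P; exists x0.
rewrite /min_over; elim/big_rec: _ => [|i n Ai [x Ax Fx]]; first by exists x1.
by rewrite /minn; case: ifP => _; [exists i | exists x].
Qed.

Definition adj (T : finType) (F : {set {set T}}) : rel T :=
  fun x y => [set x; y] \in F.

Record network := Network {
  vertex :> finType;
  edges : {set {set vertex}};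
  cost : {set vertex} -> nat;
  edge_card2 : forall e, e \in edges -> #|e| = 2;
  cost_gt0 : forall e, e \in edges -> 0 < cost e;
  network_connected : forall x y, connect (adj edges) x y
}.

Definition total_cost (N : network) : nat := \sum_(e in edges N) cost e.

(* Distinct vertices form sequences of length at most #|V|, so bounded
   sequences cover all simple paths and all simple cycles. *)
Definition simple_path (N : network) (x y : N) (p : {bseq #|N| of N}) : bool :=
  [&& path (adj (edges N)) x p, uniq (x :: p) & last x p == y].

Definition path_length (N : network) (x : N) (p : seq N) : nat :=
  sumn (pairmap (fun u v => cost [set u; v]) x p).

Definition dist (N : network) (x y : N) : nat :=
  min_over (@simple_path N x y) (path_length x).

Definition sd (N : network) (A B : {set N}) : nat :=
  min_over [pred xy : N * N | (xy.1 \in A) && (xy.2 \in B)]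
           (fun xy => dist xy.1 xy.2).

Definition acyclic (T : finType) (F : {set {set T}}) : bool :=
  [forall c : {bseq #|T| of T}, (2 < size c) ==> ~~ ucycleb (adj F) c].

Definition is_tree (T : finType) (G : {set T} * {set {set T}}) : bool :=
  [&& G.1 != set0,
      [forall e in G.2, e \subset G.1],
      [forall x in G.1, forall y in G.1, connect (adj G.2) x y]
    & acyclic G.2].

(* Any terminal can serve as the root; the root plays no role in the cost and
   is therefore not recorded. *)
Definition steiner_tree (N : network) (R : {set N})
    (G : {set N} * {set {set N}}) : bool :=
  [&& is_tree G, R \subset G.1 & G.2 \subset edges N].

Definition tree_cost (N : network) (G : {set N} * {set {set N}}) : nat :=
  \sum_(e in G.2) cost e.

Definition csmt (N : network) (R : {set N}) : nat :=
  min_over (@steiner_tree N R) (@tree_cost N).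

Definition lstar (N : network) (u : N) (I : {set N}) : nat := csmt (u |: I).

(* A heuristic is a total function on vertices and vertex sets; only its values
   on subsets of R are ever used. *)
Definition admissible (N : network) (R : {set N}) (r : N)
    (h : N -> {set N} -> nat) : Prop :=
  forall (u : N) (I : {set N}), r \in I -> I \subset R -> h u I <= lstar u I.

Notation label N := (vertex N * {set vertex N})%type.

(* Only the values of st_l and st_b on V x 2^(R \ {r}) matter.  [st_U s J = None]
   means that U(J) is not defined yet, in which case st_S s J is never read. *)
Record state (N : network) := State {
  st_l : label N -> nat;
  st_b : label N -> {set label N};
  st_Q : {set label N};
  st_P : {set label N};
  st_U : {set N} -> option nat;
  st_S : {set N} -> {set N}
}.

Definition init (N : network) (R : {set N}) (r : N) : state N :=
  State
    (fun x => if x.2 == set0 then 0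
              else if (x.1 \in R :\ r) && (x.2 == [set x.1]) then 0
              else total_cost N)
    (fun=> set0)
    [set (u, [set u]) | u in R :\ r]
    set0
    (fun=> None)
    (fun=> set0).

Definition set_label (N : network) (s : state N) (x : label N) (c : nat)
    (B : {set label N}) : state N :=
  State [eta st_l s with x |-> c] [eta st_b s with x |-> B]
        (st_Q s) (st_P s) (st_U s) (st_S s).

Definition set_bound (N : network) (s : state N) (J : {set N}) (c : nat)
    (Z : {set N}) : state N :=
  State (st_l s) (st_b s) (st_Q s) (st_P s)
        [eta st_U s with J |-> Some c] [eta st_S s with J |-> Z].

Definition enqueue (N : network) (s : state N) (x : label N) : state N :=
  State (st_l s) (st_b s) (x |: st_Q s) (st_P s) (st_U s) (st_S s).

Definition settle (N : network) (s : state N) (x : label N) : state N :=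
  State (st_l s) (st_b s) (st_Q s :\ x) (x |: st_P s) (st_U s) (st_S s).

(* The algorithm leaves open the choice among minimal elements of Q, the order
   of both for-loops and the choice among nearest terminals z.  It is therefore
   a nondeterministic program, given by the relations below. *)

Definition nearest (N : network) (v : N) (J Z : {set N}) : nat :=
  minn (sd J Z) (sd [set v] Z).

(* [prune R v J s s' t]: the call can take s to s' and return t.  An undefined
   U(J) counts as larger than every number. *)
Definition prune (N : network) (R : {set N}) (v : N) (J : {set N})
    (s s' : state N) (t : bool) : Prop :=
  let c := st_l s (v, J) + nearest v J (R :\: J) in
  let changes := if st_U s J is Some c0 then c < c0 else true in
  [/\ exists z, [/\ z \in R :\: J,
                    nearest v J [set z] = nearest v J (R :\: J)
                  & s' = if changes then set_bound s J c [set z] else s]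
    & t = (if st_U s' J is Some c' then c' < st_l s' (v, J) else false)].

Definition merge_bounds (N : network) (J1 J2 : {set N}) (s : state N) :
    state N :=
  match st_U s J1, st_U s J2 with
  | Some c1, Some c2 =>
      if (st_S s J1 :&: J2 == set0) || (st_S s J2 :&: J1 == set0)
      then set_bound s (J1 :|: J2) (c1 + c2)
                     ((st_S s J1 :|: st_S s J2) :\: (J1 :|: J2))
      else s
  | _, _ => s
  end.

Definition prune_combine (N : network) (R : {set N}) (u : N) (J1 J2 : {set N})
    (s s' : state N) (t : bool) : Prop :=
  prune R u (J1 :|: J2) (merge_bounds J1 J2 s) s' t.

Definition combine_step (N : network) (R : {set N}) (u : N) (I J : {set N})
    (s s' : state N) : Prop :=
  let c := st_l s (u, I) + st_l s (u, J) in
  if c < st_l s (u, I :|: J) then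
    exists s1 t,
      prune_combine R u I J
        (set_label s (u, I :|: J) c [set (u, I); (u, J)]) s1 t /\
      s' = if t then s1 else enqueue s1 (u, I :|: J)
  else s' = s.

Definition edge_step (N : network) (R : {set N}) (u : N) (I : {set N}) (v : N)
    (s s' : state N) : Prop :=
  let c := st_l s (u, I) + cost [set u; v] in
  if c < st_l s (v, I) then
    exists s1 t,
      prune R u I (set_label s (v, I) c [set (u, I)]) s1 t /\
      s' = if t then s1 else enqueue s1 (v, I)
  else s' = s.

Inductive run_list (X S : Type) (body : X -> S -> S -> Prop) :
    seq X -> S -> S -> Prop :=
| RunNil s : run_list body [::] s s
| RunCons x xs s s1 s2 :
    body x s s1 -> run_list body xs s1 s2 -> run_list body (x :: xs) s s2.

Definition for_each (X : finType) (S : Type) (A : {set X})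
    (body : X -> S -> S -> Prop) (s s' : S) : Prop :=
  exists xs : seq X, [/\ uniq xs, xs =i A & run_list body xs s s'].

Definition ds_iteration (N : network) (R : {set N}) (r : N)
    (h : N -> {set N} -> nat) (s s' : state N) : Prop :=
  (r, R :\ r) \notin st_P s /\
  exists u I,
    [/\ (u, I) \in st_Q s,
        forall v J, (v, J) \in st_Q s ->
          st_l s (u, I) + h u (R :\: I) <= st_l s (v, J) + h v (R :\: J)
      & let s0 := settle s (u, I) in
        exists2 s1,
          for_each [set J : {set N} | [&& J != set0, J \subset (R :\ r) :\: I
                                        & (u, J) \in st_P s0]]
                   (combine_step R u I) s0 s1
        & for_each [set v : N | [set u; v] \in edges N]
                   (edge_step R u I) s1 s'].

Definition ds_reachable (N : network) (R : {set N}) (r : N)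
    (h : N -> {set N} -> nat) (s : state N) : Prop :=
  clos_refl_trans (state N) (ds_iteration R r h) (init R r) s.

(* No iteration can be executed any more: the loop condition fails or there is
   no element of Q to choose. *)
Definition ds_halted (N : network) (R : {set N}) (r : N)
    (h : N -> {set N} -> nat) (s : state N) : Prop :=
  forall s', ~ ds_iteration R r h s s'.

(* [retraceSMT b u I F]: the recursive call on (u, I) terminates with value F. *)
Inductive retraceSMT (N : network) (b : label N -> {set label N}) :
    N -> {set N} -> {set {set N}} -> Prop :=
| RetraceSMT u I (F : label N -> {set {set N}}) :
    (forall x, x \in b (u, I) -> retraceSMT b x.1 x.2 (F x)) ->
    retraceSMT b u I
      (\bigcup_(x in b (u, I))
         (F x :|: (if u != x.1 then [set [set u; x.1]] else set0))).

(* Termination of the whole algorithm: there is no infinite run; a run that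
   cannot be continued has left the loop through its condition, or its queue is
   empty, which is possible in two degenerate cases only; and the recursion that
   builds the output terminates.  In the first degenerate case R' is empty and Q
   is empty from the start; in the second one the initial value "infinity", i.e.
   the sum of all edge costs, of l(r, R') is already optimal, so that l(r, R')
   never strictly decreases and (r, R') never enters Q. *)
Definition ds_terminates (N : network) (R : {set N}) (r : N)
    (h : N -> {set N} -> nat) : Prop :=
  Acc (fun s' s => ds_iteration R r h s s') (init R r) /\
  forall s, ds_reachable R r h s -> ds_halted R r h s ->
    ((r, R :\ r) \in st_P s \/
     st_Q s = set0 /\ (R = [set r] \/ csmt R = total_cost N)) /\
    exists F, retraceSMT (st_b s) r (R :\ r) F.

(* Main.v *)
(* Every value l(u, I) is at least l^*(u, I), so only l(r, R') <= csmt(N, R)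
   needs work.  Call (v, I) a split label if an optimal tree for R can be cut at
   v into a part spanning I and a part spanning R \ I.  A subgraph witnessing
   U(I) can replace the first part, so U(I) >= l^*(v, I) and pruning never
   discards a split label whose value has reached l^*.  By the Dreyfus-Wagner
   recursion, such labels are available in Q until (r, R') is settled, and
   admissibility of h^* bounds their keys by csmt(N, R).  An optimal value equal
   to the initial "infinity" is never enqueued, but then it is already optimal
   at the start.  Each iteration either lowers a label value or shrinks Q, which
   gives termination. *)
Require Import Defs.
From mathcomp Require Import all_boot.

Set Implicit Arguments.
Unset Strict Implicit.
Unset Printing Implicit Defensive.

(** * Connectivity under changes of the edge set, and sums over edge sets *)

Lemma adj_sym (T : finType) (F : {set {set T}}) : symmetric (adj F).
Proof. by move=> x y; rewrite /adj setUC. Qed.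

Lemma connect_adjC (T : finType) (F : {set {set T}}) : connect_sym (adj F).
Proof. exact/sym_connect_sym/adj_sym. Qed.

Lemma connect_adjS (T : finType) (F F' : {set {set T}}) :
  F \subset F' -> subrel (connect (adj F)) (connect (adj F')).
Proof.
by move=> sFF'; apply: connect_sub => x y /(subsetP sFF'); apply: connect1.
Qed.

Lemma eq_set2 (T : finType) (u v x y : T) :
  [set u; v] = [set x; y] -> (u = x /\ v = y) \/ (u = y /\ v = x).
Proof.
move=> E; have /set2P uE : u \in [set x; y] by rewrite -E set21.
have /set2P vE : v \in [set x; y] by rewrite -E set22.
have /set2P xE : x \in [set u; v] by rewrite E set21.
have /set2P yE : y \in [set u; v] by rewrite E set22.
by intuition congruence.
Qed.

(** Each crossing of [e] is replaced by the detour supplied by the hypothesis. Detours are demanded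
    only from endpoints reachable from [x], so an edge outside the component of [x] can be deleted
    freely. *)
Lemma connect_adjD1 (T : finType) (F : {set {set T}}) (e : {set T}) (x y : T) :
  (forall u v, e = [set u; v] -> connect (adj F) x u ->
     connect (adj (F :\ e)) u v) ->
  connect (adj F) x y -> connect (adj (F :\ e)) x y.
Proof.
move=> He /connectP[p]; elim: p x He => [|z p IHp] x He /=; first by move=> _ ->.
case/andP=> xz pth lst; have cxz := connect1 xz.
apply: (@connect_trans _ _ z).
  have [De|neq] := eqVneq [set x; z] e; first exact: He (esym De) (connect0 _ _).
  by apply: connect1; rewrite /adj in_setD1 neq.
by apply: IHp => // u v De zu; apply: He De (connect_trans cxz zu).
Qed.

Lemma leq_sum_subset (T : finType) (A B : {set T}) (f : T -> nat) :
  A \subset B -> \sum_(x in A) f x <= \sum_(x in B) f x.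
Proof.
by move=> /setIidPr sAB; rewrite [leqRHS](big_setID A) /= sAB leq_addr.
Qed.

Lemma leq_sum_setU (T : finType) (A B : {set T}) (f : T -> nat) :
  \sum_(x in A :|: B) f x <= \sum_(x in A) f x + \sum_(x in B) f x.
Proof.
rewrite (big_setID A) /= (setIidPr (subsetUl A B)) leq_add2l leq_sum_subset //.
by rewrite setDUl setDv set0U subsetDl.
Qed.

(** A path starting inside [P] never leaves it, so every step can be copied in [e']. *)
Lemma connect_restrict (T : finType) (e e' : rel T) (P : pred T) (x y : T) :
  (forall a b, P a -> e a b -> e' a b && P b) ->
  P x -> connect e x y -> connect e' x y.
Proof.
move=> He Px /connectP[p]; elim: p x Px => [|z p IHp] x Px /=; first by move=> _ ->.
case/andP=> /(He _ _ Px)/andP[xz Pz] pth lst.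
by apply: connect_trans (connect1 xz) _; apply: IHp.
Qed.

(** * Steiner costs through connecting edge sets, and the Dreyfus-Wagner recursion *)

Section SteinerCost.
Variable N : network.
Implicit Types (F : {set {set N}}) (A B C I J R : {set N}) (u v x y : N).

Definition edge_set_cost F := \sum_(e in F) cost e.

Lemma edge_pair e : e \in edges N -> exists u v, e = [set u; v].
Proof. by move=> /edge_card2/eqP/cards2P[u [v [_ ->]]]; exists u, v. Qed.

(* In a minimal edge set connecting v to I, an edge outside the component of v
   or on a cycle could be removed. *)
Lemma steiner_tree_of_connected F v I :
  F \subset edges N -> (forall x, x \in I -> connect (adj F) v x) ->
  exists2 G, steiner_tree (v |: I) G & G.2 \subset F.
Proof.
move=> sFE vI; pose P F' := [forall x in I, connect (adj F') v x].
have [|F1 /minsetP[PF1 minF1] sF1] := @minset_exists _ P F.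
  by apply/forall_inP => x /vI.
have {}PF1 x : x \in I -> connect (adj F1) v x by move/forall_inP: PF1; apply.
have needed e : e \in F1 ->
    (forall u w, e = [set u; w] -> connect (adj F1) v u ->
       connect (adj (F1 :\ e)) u w) -> False.
  move=> eF1 He; have/minF1 : P (F1 :\ e).
    by apply/forall_inP => x /PF1; apply: connect_adjD1.
  by move/(_ (subsetDl _ _))/setP/(_ e); rewrite !inE eqxx eF1.
exists ([set x | connect (adj F1) v x], F1) => //=.
rewrite /steiner_tree /is_tree /= (subset_trans sF1 sFE) andbT -!andbA.
apply/and5P; split; first by apply/set0Pn; exists v; rewrite inE.
- apply/forall_inP => e eF1; apply/negP => /negP/subsetPn[x xe nx].
  have [a [b De]] := edge_pair (subsetP sFE _ (subsetP sF1 _ eF1)).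
  apply: (needed e eF1) => u w De' vu; case/negP: nx; rewrite inE.
  move: xe; rewrite De' !inE => /orP[] /eqP-> //.
  by apply: connect_trans vu (connect1 _); rewrite /adj -De'.
- apply/forall_inP => x; rewrite inE => vx.
  apply/forall_inP => y; rewrite inE => vy.
  by apply: connect_trans vy; rewrite connect_adjC.
- apply/forallP => -[c sz] /=; apply/implyP => c3; apply/negP.
  case/andP; case: c c3 {sz} => [|x [|y [|z c]]] //= _.
  case/and3P=> xy yz pth; rewrite inE => /and3P[xNc /[!inE] yNc _].
  have ne a b : a != y -> b != y -> [set a; b] != [set x; y].
    move=> ay yb; apply/eqP => /setP/(_ y).
    by rewrite !inE eqxx orbT eq_sym (negPf ay) eq_sym (negPf yb).
  move: xNc yNc; rewrite !inE !negb_or => /and3P[xNy xNz xNc] /andP[yNz yNc].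
  (* The rest of the cycle leads from [y] through [z] and [c] back to [x] without using the edge
     between [x] and [y]. *)
  have yx : connect (adj (F1 :\ [set x; y])) y x.
    apply: (@connect_trans _ _ z).
      apply: connect1; rewrite /adj in_setD1 [_ \in F1]yz andbT.
      apply/eqP => /setP/(_ x).
      by rewrite !inE eqxx (negPf xNy) (negPf xNz).
    apply/connectP; exists (rcons c x); last by rewrite last_rcons.
    apply: (@sub_in_path _ (predC1 y)) pth.
      by move=> a b ay yb ab; rewrite /adj in_setD1 ne.
    rewrite /= eq_sym yNz all_rcons /= xNy.
    by apply/allP => a ac; apply: contraNneq yNc => <-.
  apply: (needed _ xy) => a b /eq_set2[[<- <-] _|[<- <-] _] //.
  by rewrite connect_adjC.
- by apply/subsetP => x; rewrite !inE => /predU1P[-> //|/PF1 //].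
Qed.

(** Together with [lstar_attained], this replaces trees by arbitrary edge sets connecting [v] to
    [I]; acyclicity plays no part from here on. *)
Lemma lstar_le F v I :
  F \subset edges N -> (forall x, x \in I -> connect (adj F) v x) ->
  lstar v I <= edge_set_cost F.
Proof.
move=> sFE vI; have [G tG sGF] := steiner_tree_of_connected sFE vI.
have [_ /(_ _ tG) le] := min_overP (@tree_cost N) tG.
exact: leq_trans le (leq_sum_subset _ sGF).
Qed.

Lemma lstar_attained v I :
  exists F, [/\ F \subset edges N, edge_set_cost F = lstar v I
    & forall x, x \in I -> connect (adj F) v x].
Proof.
(* The whole edge set connects [v] to [I], so some Steiner tree exists and [csmt] is a true minimum,
   not the default value of an empty range. *)
have [G tG _] := @steiner_tree_of_connected (edges N) v I (subxx _)
  (fun x _ => network_connected v x).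
have [[[V F] tF costF] _] := min_overP (@tree_cost N) tG.
move: tF; rewrite /steiner_tree /is_tree /= -!andbA.
case/and5P=> _ _ conn _ /andP[sIV sFE].
exists F; split=> // x xI.
have /forall_inP := forall_inP conn v (subsetP sIV _ (setU11 _ _)).
by apply; apply: (subsetP sIV); rewrite setU1r.
Qed.

Lemma lstar_mem v I : v \in I -> lstar v I = csmt I.
Proof. by rewrite /lstar => vI; rewrite (setUidPr _) // sub1set. Qed.

Lemma lstar_set0 v : lstar v set0 = 0.
Proof.
apply/eqP; rewrite -leqn0 (leq_trans (@lstar_le set0 v set0 _ _)) ?sub0set //.
  by move=> x; rewrite inE.
by rewrite /edge_set_cost big_set0.
Qed.

Lemma csmt_set1 v : csmt [set v] = 0.
Proof. by rewrite -(lstar_set0 v) /lstar setU0. Qed.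

Lemma csmt_le_total v A : v \in A -> csmt A <= total_cost N.
Proof.
move=> vA; rewrite -(lstar_mem vA) lstar_le // => x _.
exact: network_connected.
Qed.

Lemma csmtS v A B : v \in A -> A \subset B -> csmt A <= csmt B.
Proof.
move=> vA sAB; rewrite -(lstar_mem vA) -(lstar_mem (subsetP sAB _ vA)).
have [F [sF <- conn]] := lstar_attained v B.
by apply: lstar_le => // x /(subsetP sAB)/conn.
Qed.

(** Two optimal edge sets are joined at the common vertex [v]; shared edges only make the union
    cheaper. *)
Lemma csmtU v A B :
  v \in A -> v \in B -> csmt (A :|: B) <= csmt A + csmt B.
Proof.
move=> vA vB; have vAB : v \in A :|: B by rewrite inE vA.
rewrite -!(@lstar_mem v) //.
have [F [sF <- connF]] := lstar_attained v A.
have [G [sG <- connG]] := lstar_attained v B.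
apply: leq_trans (leq_sum_setU _ _ _); apply: lstar_le; first by rewrite subUset sF.
move=> x /setUP[/connF|/connG]; apply: connect_adjS; rewrite ?subsetUl //.
exact: subsetUr.
Qed.

Lemma csmt_edge u v : [set u; v] \in edges N -> csmt [set u; v] <= cost [set u; v].
Proof.
move=> uv; rewrite -(lstar_mem (set21 u v)).
rewrite (leq_trans (@lstar_le [set [set u; v]] u _ _ _)) ?sub1set //.
  move=> x /set2P[]->; first exact: connect0.
  by apply: connect1; rewrite /adj inE.
by rewrite /edge_set_cost big_set1.
Qed.

Lemma csmt_path_length x p :
  path (adj (edges N)) x p -> csmt [set x; last x p] <= path_length x p.
Proof.
rewrite /path_length; elim: p x => [|y p IHp] x /=.
  by rewrite setUid csmt_set1.
case/andP=> xy /IHp le; apply: leq_trans (leq_add (csmt_edge xy) le).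
apply: leq_trans (csmtU (set22 _ _) (set21 _ _)); apply: (@csmtS x).
  exact: set21.
by apply/subsetP => z /set2P[]->; rewrite !inE eqxx ?orbT.
Qed.

Lemma csmt_dist x y : csmt [set x; y] <= dist x y.
Proof.
have /connectP[p0 pth ->] := network_connected x y.
(* [dist] ranges over simple paths of bounded length, so shortening is what shows that its minimum
   is attained by a path. *)
case/shortenP: pth => p pth un _.
have sz : size p <= #|N|.
  by apply: ltnW; rewrite -/(size (x :: p)) -(card_uniqP un) max_card.
have sp : simple_path x (last x p) (Bseq sz).
  by rewrite /simple_path /= pth eqxx andbT -/(uniq (x :: p)) un.
rewrite /dist; have [[q /and3P[qpth _ /eqP <-] <-] _] := 
  min_overP (fun q : {bseq #|N| of N} => path_length x q) sp.
exact: csmt_path_length.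
Qed.

Lemma lstar_edge u v I :
  [set u; v] \in edges N -> lstar v I <= lstar u I + cost [set u; v].
Proof.
move=> uv; apply: leq_trans (leq_add (leqnn _) (csmt_edge uv)).
apply: leq_trans (csmtU (setU11 u I) (set21 u v)); apply: (@csmtS v).
  exact: setU11.
by apply/subsetP => z; rewrite !inE => /predU1P[->|->]; rewrite ?eqxx ?orbT.
Qed.

Lemma lstarU u I J : lstar u (I :|: J) <= lstar u I + lstar u J.
Proof.
apply: leq_trans (csmtU (setU11 u I) (setU11 u J)).
by rewrite /lstar setUACA setUid.
Qed.

(* Removing an edge {v,w} at v from an optimal edge set F for I + {v}, either
   all of I hangs at w, or F splits into the part connected to w and the rest. *)
Lemma dreyfus_wagner v I : I != set0 ->
  [\/ I = [set v],
      exists2 w, [set w; v] \in edges N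
               & lstar w I + cost [set w; v] <= lstar v I
    | exists I1 I2, [/\ I1 != set0, I2 != set0, [disjoint I1 & I2],
        I = I1 :|: I2 & lstar v I1 + lstar v I2 <= lstar v I]].
Proof.
move=> I0; have [vI|vNI] := boolP (v \in I).
  have [J0|J0] := eqVneq (I :\ v) set0.
    by constructor 1; rewrite -(setD1K vI) J0 setU0.
  (* If [v] is itself in [I], splitting off [[set v]] costs nothing. *)
  constructor 3; exists [set v], (I :\ v); split; rewrite ?setD1K //.
  - by apply/set0Pn; exists v; rewrite inE.
  - by rewrite disjoints1 !inE eqxx.
  - by rewrite (lstar_mem (set11 v)) csmt_set1 /lstar setD1K // (setUidPr _) ?sub1set.
have [F [sFE costF conn]] := lstar_attained v I.
have [w vw] : exists w, [set w; v] \in F.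
  have [i iI] := set0Pn _ I0; have /connectP[[|w p] /=] := conn i iI.
    by move=> _ Di; rewrite -Di iI in vNI.
  by case/andP=> vw _ _; exists w; rewrite setUC.
have vwE := subsetP sFE _ vw; set e := [set w; v] in vw vwE.
pose F' := F :\ e.
have sF'E : F' \subset edges N by apply: subset_trans sFE; apply: subsetDl.
have costE : lstar v I = cost e + edge_set_cost F'.
  by rewrite -costF /edge_set_cost (big_setD1 e).
have split_conn x : x \in I -> connect (adj F') v x || connect (adj F') w x.
  move/conn; have : connect (adj F') v v || connect (adj F') w v.
    by rewrite connect0.
  (* Only the start of the path is generalized. Along the path every vertex stays reachable in [F']
     from [v] or [w], since crossing [e] lands on one of these two. *)
  move: {2 3 4}v => a; move=> Ha /connectP[p]; elim: p a Ha => [|b p IHp] a Ha /=.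
    by move=> _ ->.
  case/andP=> ab pth lst; apply: (IHp b) => //.
  have [De|ne] := eqVneq [set a; b] e.
    by case: (eq_set2 De) => -[_ ->]; rewrite connect0 ?orbT.
  have ab' : adj F' a b by rewrite /adj in_setD1 ne.
  by case/orP: Ha => /connect_trans/(_ (connect1 ab'))->; rewrite ?orbT.
pose I1 := [set x in I | connect (adj F') w x]; pose I2 := I :\: I1.
have vI2 x : x \in I2 -> connect (adj F') v x.
  by rewrite !inE => /andP[+ xI]; rewrite xI /=; case/orP: (split_conn x xI) => ->.
have wI1 x : x \in I1 -> connect (adj F') w x by rewrite inE => /andP[].
have DI : I = I1 :|: I2.
  by rewrite -[LHS](setID _ I1) (setIidPr _) //; apply/subsetP => x /setIdP[].
have [I1_0|I1_0] := eqVneq I1 set0.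
  (* If nothing hangs at [w], then [F'] alone suffices, although it is cheaper than the optimum by
     [cost e > 0]. *)
  suff : lstar v I <= edge_set_cost F'.
    by rewrite costE leqNgt -[ltnLHS]add0n ltn_add2r cost_gt0.
  by apply: lstar_le => // x xI; apply: vI2; rewrite /I2 I1_0 setD0.
have [I2_0|I2_0] := eqVneq I2 set0.
  constructor 2; exists w => //; rewrite costE addnC leq_add2l lstar_le // => x.
  by rewrite DI I2_0 setU0; apply: wI1.
constructor 3; exists I1, I2; split=> //.
  by rewrite disjoint_sym /I2 disjoints_subset setDE subsetIr.
(* [F1] consists of the edges of [F'] that touch the component of [w]: with [e] it connects [v] to
   [I1], while [F2] connects [v] to [I2]. *)
pose F1 := [set f in F' | [exists a in f, connect (adj F') w a]].
pose F2 := F' :\: F1.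
have sF1 : F1 \subset F' by apply/subsetP => f /setIdP[].
have sF2 : F2 \subset F' := subsetDl _ _.
have -> : lstar v I = cost e + edge_set_cost F1 + edge_set_cost F2.
  by rewrite costE -addnA /edge_set_cost (big_setID F1) /= (setIidPr sF1).
apply: leq_add; last first.
  (* If [w] still reached [v], it would reach every element of [I2], which would then lie in [I1].
     So paths of [F'] from [v] avoid the component of [w], hence all of [F1]. *)
  have wNv : ~~ connect (adj F') w v.
    have [i iI2] := set0Pn _ I2_0; apply/negP => wv; move: (iI2).
    rewrite !inE (connect_trans wv (vI2 i iI2)) andbT.
    by case: (i \in I).
  apply: lstar_le (subset_trans sF2 sF'E) _ => x /vI2.
  apply: (@connect_restrict _ _ _ [pred a | ~~ connect (adj F') w a]) => // a b /= wa ab.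
  have wb : ~~ connect (adj F') w b.
    by apply: contra wa => /connect_trans; apply; rewrite connect_adjC connect1.
  rewrite wb andbT /adj in_setD [_ \in F']ab inE negb_and andbT orbC.
  apply/orP; left; apply/negP => /exists_inP[c /set2P[]->]; exact/negP.
apply: leq_trans (lstar_edge I1 vwE) _; rewrite addnC leq_add2l.
apply: lstar_le (subset_trans sF1 sF'E) _ => x /wI1.
apply: (@connect_restrict _ _ _ (connect (adj F') w)) => // a b wa ab.
rewrite (connect_trans wa (connect1 ab)) andbT /adj inE [_ \in F']ab.
by apply/exists_inP; exists a; rewrite ?set21.
Qed.
End SteinerCost.

(** * Distances between sets, and the meaning of the pruning bounds *)

Section Bounds.
Variable N : network.
Implicit Types (A B C I J Z : {set N}) (u v x y z : N).

Lemma lstarS v I J : I \subset J -> lstar v I <= lstar v J.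
Proof. by move=> sIJ; apply: (csmtS (setU11 v I)); apply: setUS. Qed.

Lemma sd_attained A B : A != set0 -> B != set0 ->
  exists x y, [/\ x \in A, y \in B & dist x y = sd A B].
Proof.
move=> /set0Pn[x xA] /set0Pn[y yB]; rewrite /sd.
have xyAB : [pred xy : N * N | (xy.1 \in A) && (xy.2 \in B)] (x, y).
  by rewrite /= xA.
have [[[x' y'] /= /andP[x'A y'B] Exy] _] :=
  min_overP (fun xy : N * N => dist xy.1 xy.2) xyAB.
by exists x', y'.
Qed.

Lemma sd_le A B x y : x \in A -> y \in B -> sd A B <= dist x y.
Proof.
move=> xA yB; have xyAB : [pred xy : N * N | (xy.1 \in A) && (xy.2 \in B)] (x, y).
  by rewrite /= xA.
by have [_ /(_ _ xyAB)] := min_overP (fun xy : N * N => dist xy.1 xy.2) xyAB.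
Qed.

Lemma nearest_attained v J Z : J != set0 -> Z != set0 ->
  exists x z, [/\ x \in v |: J, z \in Z & dist x z = nearest v J Z].
Proof.
move=> J0 Z0; rewrite /nearest /minn; case: ltnP => _.
  have [x [z [xJ zZ <-]]] := sd_attained J0 Z0.
  by exists x, z; rewrite setU1r.
have v0 : [set v] != set0 by apply/set0Pn; exists v; rewrite inE.
have [x [z [/set1P-> zZ <-]]] := sd_attained v0 Z0.
by exists v, z; rewrite setU11.
Qed.

Lemma nearest_le v J Z x z : x \in v |: J -> z \in Z -> nearest v J Z <= dist x z.
Proof.
rewrite /nearest geq_min => /setU1P[->|xJ] zZ; apply/orP; [right | left].
  by rewrite sd_le ?inE.
by rewrite sd_le.
Qed.

(** Supplies the terminal that a call of [prune] has to choose. *)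
Lemma nearest_set1 v J Z : J != set0 -> Z != set0 ->
  exists2 z, z \in Z & nearest v J [set z] = nearest v J Z.
Proof.
move=> J0 Z0; have [x [z [xJ zZ E]]] := nearest_attained v J0 Z0.
exists z => //; apply/eqP; rewrite eqn_leq -{1}E nearest_le ?set11 //=.
have z0 : [set z] != set0 by apply/set0Pn; exists z; rewrite inE.
by have [x' [_ [x'J /set1P-> <-]]] := nearest_attained v J0 z0; rewrite nearest_le.
Qed.

(* What makes U(J) = c, S(J) = Z correct: any connected network part through Z
   can be extended to span J at extra cost c. *)
Definition attachable J Z (c : nat) :=
  forall C, Z \subset C -> csmt (C :|: J) <= csmt C + c.

(** [C] is extended at [z] by a shortest path to [v |: J], and then by an optimal tree for
    [v |: J]. *)
Lemma attachable_nearest v J z d : J != set0 -> lstar v J <= d ->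
  attachable J [set z] (d + nearest v J [set z]).
Proof.
move=> J0 le_d C; rewrite sub1set => zC.
have z0 : [set z] != set0 by apply/set0Pn; exists z; rewrite inE.
have [x [_ [xJ /set1P-> <-]]] := nearest_attained v J0 z0.
apply: (@leq_trans (csmt C + csmt [set x; z] + lstar v J)); last first.
  by rewrite -addnA leq_add2l addnC leq_add // csmt_dist.
have le1 := csmtU zC (set22 x z).
have xC : x \in C :|: [set x; z] by rewrite !inE eqxx orbT.
apply: leq_trans (leq_add le1 (leqnn _)); apply: leq_trans (csmtU xC xJ).
apply: (@csmtS _ z); first by rewrite inE zC.
by apply/subsetP => y; rewrite !inE => /orP[]->; rewrite ?orbT.
Qed.

(** The order of attaching matters. If [Z1] avoids [J2], then [Z1] lies in [C] and [J1] can be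
    attached first; afterwards [Z2] lies in [C :|: J1], so [J2] can follow. *)
Lemma attachable_merge J1 J2 Z1 Z2 c1 c2 :
  [disjoint Z1 & J1] -> [disjoint Z2 & J2] ->
  (Z1 :&: J2 == set0) || (Z2 :&: J1 == set0) ->
  attachable J1 Z1 c1 -> attachable J2 Z2 c2 ->
  attachable (J1 :|: J2) ((Z1 :|: Z2) :\: (J1 :|: J2)) (c1 + c2).
Proof.
wlog Z1J2 : J1 J2 Z1 Z2 c1 c2 / Z1 :&: J2 == set0.
  move=> IH d1 d2 H a1 a2; case/orP: (H) => d; first by apply: IH; rewrite ?d.
  by rewrite setUC [Z1 :|: _]setUC addnC; apply: IH; rewrite ?d.
move=> d1 d2 _ a1 a2 C sC.
have sZ1 : Z1 \subset C.
  apply: subset_trans sC; apply/subsetP => z zZ1.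
  rewrite !inE zZ1 (disjointFr d1 zZ1) /=.
  by move/eqP/setP/(_ z): Z1J2; rewrite !inE zZ1 /= => ->.
have sZ2 : Z2 \subset C :|: J1.
  apply/subsetP => z zZ2; rewrite inE orbC; have [//|zJ1 /=] := boolP (z \in J1).
  by apply: (subsetP sC); rewrite !inE zZ2 (negPf zJ1) (disjointFr d2 zZ2) orbT.
rewrite setUA addnA; apply: leq_trans (a2 _ sZ2) _.
by rewrite leq_add2r a1.
Qed.
End Bounds.

(** * Split labels *)

Section SplitLabels.
Variables (N : network) (R : {set N}) (r : N).
Hypothesis rR : r \in R.
Implicit Types (I J Z : {set N}) (u v : N) (x y : label N).

Definition label_ok x := (x.2 != set0) && (x.2 \subset R :\ r).

(** The cut of an optimal tree at [x.1] is recorded by costs alone; the reverse inequality always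
    holds for [x.2] inside [R]. *)
Definition split_label x :=
  label_ok x && (lstar x.1 x.2 + lstar x.1 (R :\: x.2) <= csmt R).

Lemma root_notin I : I \subset R :\ r -> r \in R :\: I.
Proof.
by move=> sI; rewrite inE rR andbT; apply/negP => /(subsetP sI); rewrite !inE eqxx.
Qed.

(** Attaching [I] to an optimal tree for [v |: (R :\: I)], which contains [Z], spans [R]. A [c]
    below [lstar v I] would make the result cheaper than [csmt R]. *)
Lemma split_label_attachable v I Z c : split_label (v, I) ->
  attachable I Z c -> Z \subset R :\: I -> lstar v I <= c.
Proof.
case/andP=> _ /= split att sZ.
rewrite -(leq_add2r (lstar v (R :\: I))) (leq_trans split) //.
have := att (v |: (R :\: I)); rewrite [_ + c]addnC => att'.
apply: leq_trans (att' _); last by apply: subset_trans sZ _; apply: subsetUr.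
apply: (csmtS rR); apply/subsetP => z zR; rewrite !inE zR andbT orbC.
by case: (z \in I); rewrite /= ?orbT.
Qed.

(** The cut moves from [v] to [u]: the cost of the edge passes from the part for [I] to the
    complementary part. *)
Lemma split_label_edge u v I : split_label (v, I) -> [set u; v] \in edges N ->
  lstar u I + cost [set u; v] <= lstar v I -> split_label (u, I).
Proof.
case/andP=> ok /= split uv le; rewrite /split_label [label_ok _]ok /=.
apply: leq_trans split; apply: leq_trans (leq_add le (leqnn _)).
rewrite -addnA leq_add2l addnC [[set u; v]]setUC; apply: lstar_edge.
by rewrite setUC.
Qed.

(** The subtree spanning [J] changes sides of the cut. *)
Lemma split_label_setU v I J : I != set0 -> split_label (v, I :|: J) ->
  lstar v I + lstar v J <= lstar v (I :|: J) -> split_label (v, I).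
Proof.
move=> I0 /andP[/andP[_ /= sIJ] split] le.
rewrite /split_label /label_ok /= I0 (subset_trans (subsetUl _ _) sIJ) /=.
apply: leq_trans split; apply: leq_trans (leq_add le (leqnn _)).
rewrite -addnA leq_add2l; apply: leq_trans (lstarU _ _ _); apply: lstarS.
apply/subsetP => z; rewrite !inE negb_or => /andP[-> ->].
by case: (z \in J).
Qed.

Lemma split_label_root : R :\ r != set0 -> split_label (r, R :\ r).
Proof.
move=> R0; rewrite /split_label /label_ok R0 subxx /= setDDr setDv set0U.
by rewrite (setIidPr _) ?sub1set // (lstar_mem (set11 r)) csmt_set1 addn0 /lstar setD1K.
Qed.
End SplitLabels.

(** * Effect of single steps and of the for-loops *)

Section Steps.
Variables (N : network) (R : {set N}) (r : N).
Hypothesis rR : r \in R.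
Implicit Types (I J Z : {set N}) (u v : N) (x y : label N) (s t : state N).

(** [sound_bound] certifies the pruning bounds. By [sound_pred], back pointers decrease
    lexicographically, first in the set and then in the value, which makes retracing end. *)
Record sound s : Prop := Sound {
  sound_lstar : forall x, lstar x.1 x.2 <= st_l s x;
  sound_init : forall x, st_l s x <= st_l (init R r) x;
  sound_bound : forall J c, st_U s J = Some c ->
    attachable J (st_S s J) c /\ st_S s J \subset R :\: J;
  sound_label : forall x, x \in st_Q s :|: st_P s -> label_ok R r x;
  sound_pred : forall x y, x \in st_b s y ->
    (x.2 \proper y.2) || ((x.2 == y.2) && (st_l s x < st_l s y))
}.

Record same_labels s s' : Prop := SameLabels {
  same_l : st_l s' = st_l s;
  same_b : st_b s' = st_b s;
  same_Q : st_Q s' = st_Q s;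
  same_P : st_P s' = st_P s
}.

(** [ext_new] serves termination: whatever enters the queue has lowered its value. [ext_split]
    states that pruning never withholds a split label that has just reached its optimum. *)
Record extends s s' : Prop := Extends {
  ext_l : forall x, st_l s' x <= st_l s x;
  ext_P : st_P s' = st_P s;
  ext_Q : st_Q s \subset st_Q s';
  ext_new : forall x, x \in st_Q s' -> x \in st_Q s \/ st_l s' x < st_l s x;
  ext_split : forall x, split_label R r x -> st_l s' x < st_l s x ->
    st_l s' x <= lstar x.1 x.2 -> x \in st_Q s'
}.

Lemma same_labels_trans s1 s2 s3 :
  same_labels s1 s2 -> same_labels s2 s3 -> same_labels s1 s3.
Proof. by case=> l1 b1 Q1 P1 [l2 b2 Q2 P2]; split; congruence. Qed.

Lemma extends_refl s : extends s s.
Proof. by split=> // [x|x _]; [left | rewrite ltnn]. Qed.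

Lemma extends_trans s1 s2 s3 : extends s1 s2 -> extends s2 s3 -> extends s1 s3.
Proof.
case=> l1 P1 Q1 n1 sp1 [l2 P2 Q2 n2 sp2].
split=> [x|||x|x spx lt13 tight].
- exact: leq_trans (l2 x) (l1 x).
- by rewrite P2.
- exact: subset_trans Q1 Q2.
- case/n2=> [/n1[|lt12]|lt23]; first by left.
    by right; apply: leq_ltn_trans lt12.
  by right; apply: leq_trans lt23 (l1 x).
- have [lt23|le23] := ltnP (st_l s3 x) (st_l s2 x); first exact: sp2.
  have E : st_l s2 x = st_l s3 x by apply/eqP; rewrite eqn_leq le23 l2.
  by apply: (subsetP Q2); apply: sp1; rewrite ?E.
Qed.

Lemma lstar_le_init x : lstar x.1 x.2 <= st_l (init R r) x.
Proof.
case: x => u I /=; case: eqP => [->|_]; first by rewrite lstar_set0.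
case: ifP => [/andP[_ /eqP->]|_]; first by rewrite (lstar_mem (set11 u)) csmt_set1.
exact: csmt_le_total (setU11 u I).
Qed.

Lemma label_ok_queue_init x : x \in st_Q (init R r) -> label_ok R r x.
Proof.
case/imsetP=> u uR ->; rewrite /label_ok /= sub1set uR andbT.
by apply/set0Pn; exists u; rewrite inE.
Qed.

Lemma sound_init_state : sound (init R r).
Proof.
split=> // [|x|x y]; first exact: lstar_le_init; last by rewrite inE.
by rewrite setU0; apply: label_ok_queue_init.
Qed.

Lemma set_label_sound s x c (B : {set label N}) : sound s ->
  c < st_l s x -> lstar x.1 x.2 <= c ->
  (forall y, y \in B ->
     (y.2 \proper x.2) || ((y.2 == x.2) && (st_l s y < c))) ->
  sound (set_label s x c B).
Proof.
case=> sl si sb so sp ltc lec HB; split=> //= [y|y|y z].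
- by case: eqP => [->|_].
- by case: eqP => [->|_] //; apply: leq_trans (ltnW ltc) (si x).
- case: (z =P x) => [->|_].
    (* [x] cannot be its own predecessor: its old value would have to be below [c]. *)
    move=> yB; case: (y =P x) => [Dy|_]; last exact: HB.
    have := HB y yB; rewrite Dy properxx eqxx /= => lt.
    by have := ltn_trans ltc lt; rewrite ltnn.
  move/sp; case: (y =P x) => [->|_] // /orP[->//|/andP[-> lt]].
  by rewrite (ltn_trans ltc lt) orbT.
Qed.

Lemma set_bound_sound s J c Z : sound s -> attachable J Z c ->
  Z \subset R :\: J -> sound (set_bound s J c Z).
Proof.
case=> sl si sb so sp att sZ; split=> //= K d.
by case: eqP => [-> [<-]|_]; [|apply: sb].
Qed.

Lemma merge_bounds_sound s J1 J2 : sound s ->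
  sound (merge_bounds J1 J2 s) /\ same_labels s (merge_bounds J1 J2 s).
Proof.
move=> ss; rewrite /merge_bounds; case E1: (st_U s J1) => [c1|//].
case E2: (st_U s J2) => [c2|//]; case: ifP => // disj; split=> //.
have [att1 sZ1] := sound_bound ss E1; have [att2 sZ2] := sound_bound ss E2.
have dis Z J : Z \subset R :\: J -> [disjoint Z & J].
  by move=> sZ; rewrite disjoints_subset (subset_trans sZ) // setDE subsetIr.
apply: set_bound_sound => //; first by apply: attachable_merge; rewrite ?dis.
apply: setSD; rewrite subUset (subset_trans sZ1 (subsetDl _ _)).
exact: subset_trans sZ2 (subsetDl _ _).
Qed.

(** The bound for [J] is at least [lstar w J] for every split label [(w, J)]. The vertex [w] is
    arbitrary because [edge_step] tests [(u, I)] to decide about its neighbour [(v, I)]. *)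
Lemma prune_sound v J s s' b : J != set0 -> sound s -> prune R v J s s' b ->
  [/\ sound s', same_labels s s'
    & b -> forall w, split_label R r (w, J) -> lstar w J < st_l s (v, J)].
Proof.
move=> J0 ss [[z [zJ En Es']] Eb].
have [ss' same] : sound s' /\ same_labels s s'.
  rewrite Es'; case: (if _ is Some _ then _ else _) => //; split=> //.
  apply: set_bound_sound; rewrite ?sub1set // -En.
  exact: attachable_nearest J0 (sound_lstar ss (v, J)).
split=> //; rewrite Eb; case E: (st_U s' J) => [c|//].
rewrite (same_l same) => lt w split; have [att sZ] := sound_bound ss' E.
exact: leq_ltn_trans (split_label_attachable rR split att sZ) lt.
Qed.

(** The root lies outside [J], so there is a terminal to choose. *)
Lemma prune_total v J s : J != set0 -> J \subset R :\ r ->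
  exists s' b, prune R v J s s' b.
Proof.
move=> J0 sJ; have [|z zZ Ez] := @nearest_set1 N v J (R :\: J) J0.
  by apply/set0Pn; exists r; apply: root_notin sJ.
by do 2!eexists; split; [exists z; split|].
Qed.

(** Common end of both loop bodies: [b] is the answer of the pruning call, and a split label that it
    rejects is still above its optimum. *)
Lemma relax_extends s s1 x c B (b : bool) : sound s -> sound s1 ->
  label_ok R r x -> c < st_l s x -> same_labels (set_label s x c B) s1 ->
  (b -> split_label R r x -> lstar x.1 x.2 < c) ->
  let s' := if b then s1 else enqueue s1 x in
  [/\ sound s', extends s s' & st_l s' x <= c].
Proof.
move=> ss ss1 okx ltc [El Eb EQ EP] Hb s'.
have ls' y : st_l s' y = if y == x then c else st_l s y.
  by rewrite /s'; case: (b); rewrite /= El.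
have Qs' : st_Q s' = if b then st_Q s else x |: st_Q s.
  by rewrite /s'; case: (b); rewrite /= EQ.
split; last by rewrite ls' eqxx.
  rewrite /s'; case: (b) => //; case: ss1 => sl si sb so sp.
  by split=> //= y; rewrite -setUA => /setU1P[->|/so].
split=> [y|||y|y spy].
- by rewrite ls'; case: eqP => [->|//]; apply: ltnW.
- by rewrite /s'; case: (b).
- by rewrite Qs'; case: (b) => //; apply: subsetU1.
- rewrite Qs' ls'; case: (b) => [|/setU1P[->|]]; [by left| |by left].
  by right; rewrite eqxx.
- rewrite Qs' ls'; case: eqP => [Dy|_]; last by rewrite ltnn.
  rewrite Dy in spy *; move=> _; case: (b) Hb => [/(_ isT spy)|_ _].
    by rewrite ltnNge => /negPf->.
  exact: setU11.
Qed.

Lemma combine_step_sound u I J s s' : label_ok R r (u, I) ->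
  J != set0 -> J \subset (R :\ r) :\: I -> sound s ->
  combine_step R u I J s s' ->
  [/\ sound s', extends s s'
    & st_l s' (u, I :|: J) <= st_l s (u, I) + st_l s (u, J)].
Proof.
case/andP=> /= I0 sI J0; rewrite subsetD => /andP[sJ dJI] ss.
rewrite /combine_step; case: ltnP => [lt|le ->]; last first.
  by split=> //; apply: extends_refl.
set c := st_l s (u, I) + st_l s (u, J); set x := (u, I :|: J) in lt *.
have okx : label_ok R r x.
  by rewrite /label_ok /= setU_eq0 negb_and I0 subUset sI.
case=> s1 [b [pr ->]].
(* [I] and [J] are disjoint and nonempty, so both back pointers lead to proper subsets. *)
have IJ : I \proper I :|: J.
  have [j jJ] := set0Pn _ J0; rewrite properUl //; apply/subsetPn; exists j => //.
  by rewrite (disjointFr dJI).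
have JI : J \proper I :|: J.
  have [i iI] := set0Pn _ I0; rewrite properUr //; apply/subsetPn; exists i => //.
  by rewrite (disjointFl dJI).
have ss0 : sound (set_label s x c [set (u, I); (u, J)]).
  apply: set_label_sound => // [|y /set2P[]->]; rewrite /= ?IJ ?JI //.
  apply: leq_trans (lstarU _ _ _) _.
  exact: leq_add (sound_lstar ss (u, I)) (sound_lstar ss (u, J)).
have [ssm samem] := merge_bounds_sound I J ss0.
have [|ss1 same1 Hb] := prune_sound _ ssm pr; first by case/andP: okx.
apply: relax_extends (same_labels_trans samem same1) _ => // /Hb/[apply].
by rewrite (same_l samem) /= eqxx.
Qed.

Lemma edge_step_sound u I v s s' : label_ok R r (u, I) ->
  [set u; v] \in edges N -> sound s -> edge_step R u I v s s' ->
  [/\ sound s', extends s s'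
    & st_l s' (v, I) <= st_l s (u, I) + cost [set u; v]].
Proof.
move=> ok uv ss; have [I0 sI] := andP ok.
rewrite /edge_step; case: ltnP => [lt|le ->]; last first.
  by split=> //; apply: extends_refl.
set c := st_l s (u, I) + cost [set u; v] in lt *.
have lt_c : st_l s (u, I) < c by rewrite -[ltnLHS]addn0 ltn_add2l cost_gt0.
case=> s1 [b [pr ->]].
have ss0 : sound (set_label s (v, I) c [set (u, I)]).
  apply: set_label_sound => // [|y /set1P->]; last by rewrite /= eqxx lt_c orbT.
  apply: leq_trans (lstar_edge I uv) _.
  by rewrite leq_add2r; apply: (sound_lstar ss (u, I)).
have [ss1 same1 Hb] := prune_sound I0 ss0 pr.
apply: relax_extends same1 _ => // /Hb/[apply] lt1.
(* The tested value is that of [(u, I)], which is at most the new value [c] of [(v, I)]. *)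
apply: leq_trans lt1 _; rewrite /=.
by case: ifP => // _; apply: ltnW.
Qed.

Lemma combine_step_total u I J s : label_ok R r (u, I) ->
  J \subset (R :\ r) :\: I -> exists s', combine_step R u I J s s'.
Proof.
case/andP=> /= I0 sI; rewrite subsetD => /andP[sJ _].
rewrite /combine_step; case: (_ < _); last by exists s.
have [||s' [b pr]] := @prune_total u (I :|: J) (merge_bounds I J
  (set_label s (u, I :|: J) (st_l s (u, I) + st_l s (u, J)) [set (u, I); (u, J)])).
- by rewrite setU_eq0 negb_and I0.
- by rewrite subUset sI.
by eexists; exists s', b.
Qed.

Lemma edge_step_total u I v s : label_ok R r (u, I) ->
  exists s', edge_step R u I v s s'.
Proof.
case/andP=> /= I0 sI; rewrite /edge_step; case: (_ < _); last by exists s.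
have [s' [b pr]] := @prune_total u I
  (set_label s (v, I) (st_l s (u, I) + cost [set u; v]) [set (u, I)]) I0 sI.
by eexists; exists s', b.
Qed.

(** Each pass relaxes its target against the value current at that time. Earlier passes only lower
    this value and later ones only lower the target, so the bound relates the final state to the
    initial one. *)
Lemma for_each_extends (X : finType) (A : {set X})
    (body : X -> state N -> state N -> Prop)
    (target : X -> label N) (value : X -> state N -> nat) s s' :
  (forall (a : X) t t', extends t t' -> value a t' <= value a t) ->
  (forall a t t', a \in A -> sound t -> body a t t' ->
     [/\ sound t', extends t t' & st_l t' (target a) <= value a t]) ->
  sound s -> for_each A body s s' ->
  [/\ sound s', extends s s'
    & forall a, a \in A -> st_l s' (target a) <= value a s].
Proof.
move=> mono step ss [xs [_ Exs run]].
suff [ss' ext val] : [/\ sound s', extends s s'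
    & forall a, a \in xs -> st_l s' (target a) <= value a s].
  by split=> // a; rewrite -Exs; apply: val.
have {Exs}step0 a t t' : a \in xs -> sound t -> body a t t' ->
    [/\ sound t', extends t t' & st_l t' (target a) <= value a t].
  by rewrite Exs; apply: step.
elim: run ss step0 {step} => [t st _|a {}xs t t1 t2 bd _ IH st step].
  by split=> //; apply: extends_refl.
have [st1 ext1 val1] := step a t t1 (mem_head _ _) st bd.
have [|st2 ext2 val2] := IH st1.
  by move=> b t' t'' bxs; apply: step; rewrite inE bxs orbT.
split=> //; first exact: extends_trans ext1 ext2.
move=> b; rewrite inE => /predU1P[->|bxs].
  exact: leq_trans (ext_l ext2 _) val1.
exact: leq_trans (val2 b bxs) (mono _ _ _ ext1).
Qed.

Lemma for_each_total (X : finType) (A : {set X})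
    (body : X -> state N -> state N -> Prop) s :
  (forall a t, a \in A -> exists t', body a t t') ->
  exists s', for_each A body s s'.
Proof.
move=> tot; suff [s' run] : exists s', run_list body (enum A) s s'.
  by exists s', (enum A); split=> //; [apply: enum_uniq | apply: mem_enum].
have {}tot a t : a \in enum A -> exists t', body a t t'.
  by rewrite mem_enum; apply: tot.
elim: (enum A) s tot => [|a xs IH] s tot; first by exists s; constructor.
have [s1 bd] := tot a s (mem_head _ _).
have [|s2 run] := IH s1; first by move=> b t bxs; apply: tot; rewrite inE bxs orbT.
by exists s2; apply: RunCons bd run.
Qed.
End Steps.

(** * Iterations of the main loop *)

Section Run.
Variables (N : network) (R : {set N}) (r : N) (h : N -> {set N} -> nat).
Hypothesis rR : r \in R.
Implicit Types (I J : {set N}) (u v : N) (x y : label N) (s t : state N).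

Lemma settle_sound s x : x \in st_Q s -> sound R r s -> sound R r (settle s x).
Proof.
move=> xQ [sl si sb so sp]; split=> //= y yQP; apply: so; move: yQP.
by rewrite !inE => /orP[/andP[_ ->]//|/predU1P[->|->]]; rewrite ?xQ ?orbT.
Qed.

(** The relaxation inequalities at the chosen label hold even for pruned results, since pruning
    affects only the queue. *)
Lemma iteration_relaxes u I s s1 s' : sound R r s -> (u, I) \in st_Q s ->
  for_each [set J : {set N} | [&& J != set0, J \subset (R :\ r) :\: I
                                & (u, J) \in st_P (settle s (u, I))]]
           (combine_step R u I) (settle s (u, I)) s1 ->
  for_each [set v : N | [set u; v] \in edges N] (edge_step R u I) s1 s' ->
  [/\ sound R r s', extends R r (settle s (u, I)) s',
      forall v, [set u; v] \in edges N ->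
        st_l s' (v, I) <= st_l s (u, I) + cost [set u; v]
    & forall J, J != set0 -> J \subset (R :\ r) :\: I ->
        (u, J) \in st_P (settle s (u, I)) ->
        st_l s' (u, I :|: J) <= st_l s (u, I) + st_l s (u, J)].
Proof.
move=> ss uQ loopJ loopv; have ss0 := settle_sound uQ ss.
have ok : label_ok R r (u, I) by apply: (sound_label ss); rewrite inE uQ.
have [||ss1 ext1 val1] := for_each_extends (target := fun J => (u, I :|: J))
  (value := fun J t => st_l t (u, I) + st_l t (u, J)) _ _ ss0 loopJ.
- by move=> J t t' e; apply: leq_add; apply: ext_l e _.
- move=> J t t' /[!inE] /and3P[J0 sJ _] st.
  exact: (combine_step_sound rR ok J0 sJ st).
have [||ss' ext2 val2] := for_each_extends (target := fun v => (v, I))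
  (value := fun v t => st_l t (u, I) + cost [set u; v]) _ _ ss1 loopv.
- by move=> v t t' e; rewrite leq_add2r; apply: ext_l e _.
- by move=> v t t' /[!inE] uv st; apply: (edge_step_sound rR ok uv st).
split=> //; first exact: extends_trans ext1 ext2.
  move=> v uv; apply: leq_trans (val2 v _) _; first by rewrite inE.
  by rewrite leq_add2r; apply: ext_l ext1 _.
move=> J J0 sJ PJ; apply: leq_trans (ext_l ext2 _) _.
by apply: val1; rewrite inE J0 sJ.
Qed.

Lemma ds_iteration_sound s s' : sound R r s -> ds_iteration R r h s s' ->
  sound R r s'.
Proof.
move=> ss [_ [u [I [uQ _ [s1 loopJ loopv]]]]].
by have [] := iteration_relaxes ss uQ loopJ loopv.
Qed.

Lemma ds_iteration_total s : sound R r s -> (r, R :\ r) \notin st_P s ->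
  st_Q s != set0 -> exists s', ds_iteration R r h s s'.
Proof.
move=> ss nP /set0Pn[x0 x0Q].
pose key x := st_l s x + h x.1 (R :\: x.2).
have [[u I] uQ min] := @arg_minnP _ x0 (mem (st_Q s)) key x0Q.
have ok : label_ok R r (u, I).
  by apply: (sound_label ss); rewrite inE [_ \in st_Q s]uQ.
have [|s1 loopJ] := @for_each_total N _
  [set J : {set N} | [&& J != set0, J \subset (R :\ r) :\: I
                       & (u, J) \in st_P (settle s (u, I))]]
  (combine_step R u I) (settle s (u, I)).
  by move=> J t /[!inE] /and3P[_ sJ _]; apply: (combine_step_total rR t ok sJ).
have [|s' loopv] := @for_each_total N _
  [set v : N | [set u; v] \in edges N] (edge_step R u I) s1.
  by move=> v t _; apply: (edge_step_total rR v t ok).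
exists s'; split=> //; exists u, I; split=> //; first by move=> v J /min.
by exists s1.
Qed.

(** * Termination of the loop and of the retracing *)

(** A lexicographic order: the factor exceeds every queue size, so a drop in the sum of values
    outweighs any growth of the queue. *)
Definition run_measure s := (\sum_x st_l s x) * #|{: label N}|.+1 + #|st_Q s|.

Lemma ds_iteration_measure s s' : sound R r s -> ds_iteration R r h s s' ->
  run_measure s' < run_measure s.
Proof.
move=> ss [_ [u [I [uQ _ [s1 loopJ loopv]]]]].
have [_ [le _ _ new _] _ _] := iteration_relaxes ss uQ loopJ loopv.
rewrite /run_measure; case: (boolP [forall x, st_l s' x == st_l s x]).
  (* With all values unchanged nothing new is queued, and the chosen label has left. *)
  move/forallP => eq; rewrite (eq_bigr (st_l s)); last by move=> x _; apply/eqP.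
  rewrite ltn_add2l (cardsD1 (u, I) (st_Q s)) uQ ltnS; apply/subset_leq_card.
  by apply/subsetP => x /new[]//; rewrite /= (eqP (eq x)) ltnn.
case/forallPn=> x ne; have lt : \sum_y st_l s' y < \sum_y st_l s y.
  rewrite (bigD1 x) //= [ltnRHS](bigD1 x) //= -addSn leq_add ?leq_sum //.
  by rewrite ltn_neqAle ne le.
apply: leq_trans (leq_addr _ _).
apply: (@leq_trans ((\sum_y st_l s' y).+1 * #|{: label N}|.+1)).
  by rewrite mulSn addnC ltn_add2r ltnS max_card.
by rewrite leq_mul2r lt orbT.
Qed.

Lemma ds_terminating s : sound R r s ->
  Acc (fun s' s => ds_iteration R r h s s') s.
Proof.
have [n] := ubnP (run_measure s); elim: n s => [|n IH] s; first by rewrite ltn0.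
move=> lt ss.
constructor=> s' it; apply: IH (ds_iteration_sound ss it).
exact: leq_trans (ds_iteration_measure ss it) lt.
Qed.

(** Values never exceed [total_cost N], so with weight [(total_cost N).+1] losing one element of the
    set outweighs any rise of the value. *)
Lemma retrace_exists s x : sound R r s ->
  exists F, retraceSMT (st_b s) x.1 x.2 F.
Proof.
move=> ss; have bounded y : st_l s y <= total_cost N.
  apply: leq_trans (sound_init ss y) _; rewrite /=.
  by do 2!case: ifP => // _.
have [n] := ubnP (#|x.2| * (total_cost N).+1 + st_l s x).
elim: n x => [|n IH] [u I]; first by rewrite ltn0.
move=> lt.
have /fin_all_exists[F HF] : forall y, exists F,
    y \in st_b s (u, I) -> retraceSMT (st_b s) y.1 y.2 F.
  move=> y; have [yb|] := boolP (y \in st_b s (u, I)); last by exists set0.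
  have [|F HF] := IH y; last by exists F.
  apply: leq_trans (_ : #|I| * (total_cost N).+1 + st_l s (u, I) <= n) => //.
  case/orP: (sound_pred ss yb) => [/proper_card /= prop|/andP[/eqP-> lty]].
    apply: leq_trans (leq_addr _ _).
    apply: (@leq_trans (#|y.2|.+1 * (total_cost N).+1)).
      by rewrite mulSn addnC ltn_add2r ltnS.
    by rewrite leq_mul2r prop orbT.
  by rewrite ltn_add2l.
by eexists; apply: RetraceSMT HF.
Qed.

(** * The invariant behind optimality *)

Definition tight s x := split_label R r x && (st_l s x <= lstar x.1 x.2).

(** A settled label may be queued again while staying in [st_P], hence the differences
    [st_P s :\: st_Q s]. Pruning may lower a settled value without queueing it, hence the
    restriction to [tight] labels. *)
Record ds_invariant s : Prop := DsInvariant {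
  inv_sound : sound R r s;
  inv_queued : forall x, tight s x -> x \in st_Q s :|: st_P s;
  inv_edge : forall u v I, tight s (u, I) -> (u, I) \in st_P s :\: st_Q s ->
    [set u; v] \in edges N -> st_l s (v, I) <= st_l s (u, I) + cost [set u; v];
  inv_combine : forall u I J, tight s (u, I) -> tight s (u, J) ->
    (u, I) \in st_P s :\: st_Q s -> (u, J) \in st_P s :\: st_Q s ->
    [disjoint I & J] ->
    st_l s (u, I :|: J) <= st_l s (u, I) + st_l s (u, J);
  inv_root : (r, R :\ r) \in st_P s -> st_l s (r, R :\ r) <= csmt R
}.

(* Following an optimal tree from its leaves to x, the first label that is not
   settled with its final value is in the queue. *)
Lemma frontier s x : ds_invariant s -> split_label R r x ->
  (tight s x /\ x \in st_P s :\: st_Q s) \/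
  exists2 y, y \in st_Q s & tight s y.
Proof.
(* The measure drops in both recursive cases: an edge has positive cost, and a split leaves two
   nonempty smaller sets. *)
move=> [ss queued edge combine _]; have [n] := ubnP (#|x.2| + lstar x.1 x.2).
elim: n x => [|n IH] [v I]; first by rewrite ltn0.
move=> /= /ltnSE-le_n spI.
have settled : st_l s (v, I) <= lstar v I ->
    (tight s (v, I) /\ (v, I) \in st_P s :\: st_Q s) \/
    exists2 y, y \in st_Q s & tight s y.
  move=> le; have tI : tight s (v, I) by rewrite /tight spI.
  case: (boolP ((v, I) \in st_Q s)) => [vQ|vNQ]; first by right; exists (v, I).
  by left; move: (queued _ tI); rewrite !inE (negPf vNQ).
have /andP[/andP[/= I0 sI] _] := spI.
case: (dreyfus_wagner v I0) => [DI|[w wv le]|[I1 [I2 [I1_0 I2_0 dis DI le]]]].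
- have vR : v \in R :\ r by apply: (subsetP sI); rewrite DI set11.
  apply: settled; apply: leq_trans (sound_init ss _) _ => /=.
  by rewrite (negPf I0) vR DI eqxx.
- have spw : split_label R r (w, I) by apply: split_label_edge spI wv le.
  have [||[tw wPQ]|] := IH (w, I) => //=; last by right.
    apply: leq_trans le_n; rewrite ltn_add2l; apply: leq_trans le.
    by rewrite -[ltnLHS]addn0 ltn_add2l cost_gt0.
  apply: settled; apply: leq_trans (edge w v I tw wPQ wv) (leq_trans _ le).
  by rewrite leq_add2r; case/andP: tw.
have sp1 : split_label R r (v, I1).
  by apply: (split_label_setU (J := I2) I1_0); rewrite -DI.
have sp2 : split_label R r (v, I2).
  by apply: (split_label_setU (J := I1) I2_0); rewrite setUC -DI // addnC.
have cardI : #|I| = #|I1| + #|I2| by rewrite DI cardsU disjoint_setI0 ?cards0 ?subn0.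
have [||[t1 PQ1]|] := IH (v, I1) => //=; last by right.
  apply: leq_trans le_n; rewrite -addSn leq_add //.
    by rewrite cardI -[ltnLHS]addn0 ltn_add2l card_gt0.
  exact: leq_trans (leq_addr _ _) le.
have [||[t2 PQ2]|] := IH (v, I2) => //=; last by right.
  apply: leq_trans le_n; rewrite -addSn leq_add //.
    by rewrite cardI -[ltnLHS]add0n ltn_add2r card_gt0.
  exact: leq_trans (leq_addl _ _) le.
apply: settled; apply: leq_trans le; rewrite {1}DI.
apply: leq_trans (combine _ _ _ t1 t2 PQ1 PQ2 dis) _.
by case/andP: t1 => _ /= le1; case/andP: t2 => _ /= le2; apply: leq_add.
Qed.

(** [frontier] is applied to the root label, which is a split label but not settled. *)
Lemma queue_tight s : ds_invariant s -> (r, R :\ r) \notin st_P s ->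
  R :\ r != set0 -> exists2 x, x \in st_Q s & tight s x.
Proof.
move=> inv nP R0; have [[_]|//] := frontier inv (split_label_root rR R0).
by rewrite inE (negPf nP) andbF.
Qed.

Lemma ds_iteration_invariant s s' : admissible R r h -> ds_invariant s ->
  ds_iteration R r h s s' -> ds_invariant s'.
Proof.
move=> adm inv [nP [u [I [uQ min [s1 loopJ loopv]]]]].
have ss := inv_sound inv.
have /andP[/= I0 sI] : label_ok R r (u, I).
  by apply: (sound_label ss); rewrite inE uQ.
have [ss' [le EP sQ _ new] edge combine] := iteration_relaxes ss uQ loopJ loopv.
(* Had the value dropped in this iteration, [ext_split] would have put [x] in the queue. *)
have tightW x : tight s' x -> x \notin st_Q s' ->
    tight s x /\ st_l s' x = st_l s x.
  case/andP=> sp tl xNQ; have E : st_l s' x = st_l s x.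
    apply/eqP; rewrite eqn_leq le leqNgt; apply: contra xNQ => lt; exact: new.
  by rewrite /tight sp -E.
have oldP x : x \in st_P s' :\: st_Q s' -> x = (u, I) \/ x \in st_P s :\: st_Q s.
  rewrite inE EP /= => /andP[xNQ /setU1P[->|xP]]; first by left.
  have [->|ne] := eqVneq x (u, I); first by left.
  right; rewrite inE xP andbT; apply: contra xNQ => xQ.
  by apply: (subsetP sQ); rewrite !inE ne.
have NQ x : x \in st_P s' :\: st_Q s' -> x \notin st_Q s' by case/setDP.
split=> //.
- move=> x tx; rewrite inE; have [//|xNQ /=] := boolP (x \in st_Q s').
  have [t0 _] := tightW x tx xNQ; rewrite EP /= !inE.
  have [//|ne /=] := eqVneq x (u, I).
  have /setUP[xQ|//] := inv_queued inv t0.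
  by case/negP: xNQ; apply: (subsetP sQ); rewrite !inE ne.
- move=> w v K tw wPQ wv; have [tw0 ->] := tightW _ tw (NQ _ wPQ).
  case: (oldP _ wPQ) => [[Dw DK]|wPQ0]; first by subst w K; apply: edge.
  exact: leq_trans (le _) (inv_edge inv tw0 wPQ0 wv).
- move=> w K L tK tL KPQ LPQ dis.
  have [tK0 ->] := tightW _ tK (NQ _ KPQ); have [tL0 ->] := tightW _ tL (NQ _ LPQ).
  have sub x : tight s' x -> [disjoint x.2 & I] ->
      x.2 != set0 /\ x.2 \subset (R :\ r) :\: I.
    by case/andP=> /andP[/andP[? sx] _] _ d; rewrite subsetD sx.
  have inP x : x \in st_P s' :\: st_Q s' -> x \in st_P (settle s (u, I)).
    by rewrite -EP => /setDP[].
  case: (oldP _ KPQ) => [[Dw DK]|KPQ0].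
    subst w K; have [|L0 sL] := sub _ tL; first by rewrite disjoint_sym.
    by apply: combine => //; apply: inP.
  case: (oldP _ LPQ) => [[Dw DL]|LPQ0].
    subst w L; have [//|K0 sK] := sub _ tK.
    by rewrite setUC addnC; apply: combine => //; apply: inP.
  exact: leq_trans (le _) (inv_combine inv tK0 tL0 KPQ0 LPQ0 dis).
- rewrite EP /= in_setU1 (negPf nP) orbF => /eqP[Eu EI]; subst u I.
  (* The root key is at most the key of a tight queued label [(v, K)]; by admissibility that is at
     most [lstar v K + lstar v (R :\: K)], hence at most [csmt R]. *)
  have [[v K] vQ /andP[/andP[/andP[/= K0 sK] split] tl]] := queue_tight inv nP I0.
  apply: leq_trans (le _) _; apply: leq_trans (leq_addr _ _) _.
  apply: leq_trans (min v K vQ) _; apply: leq_trans split.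
  apply: leq_add tl _; apply: adm; last exact: subsetDl.
  exact: root_notin sK.
Qed.

(** A split label has optimum at most [csmt R], so strictness keeps it below the initial infinity.
    Only the queued singletons are tight at the start. *)
Lemma ds_invariant_init : csmt R < total_cost N -> ds_invariant (init R r).
Proof.
move=> lt; split; first exact: sound_init_state; last by rewrite in_set0.
- move=> [u I] /andP[/andP[/andP[/= I0 _] split] /=].
  rewrite setU0 (negPf I0); case: ifP => [/andP[uR /eqP->] _|_ le].
    by apply/imsetP; exists u.
  have := leq_trans (leq_addr _ _) split; rewrite leqNgt.
  by rewrite (leq_trans lt le).
- by move=> u v I _; rewrite set0D in_set0.
- by move=> u I J _ _; rewrite set0D in_set0.
Qed.

Lemma ds_reachable_ind (P : state N -> Prop) s :
  (forall s s', P s -> ds_iteration R r h s s' -> P s') ->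
  P (init R r) -> ds_reachable R r h s -> P s.
Proof.
move=> step P0 reach; elim: reach P0 => //.
  by move=> s1 s2 it P1; apply: step it.
by move=> s1 s2 s3 _ IH1 _ IH2 /IH1/IH2.
Qed.
End Run.

(** * Assembly, including the degenerate cases of an empty queue *)

Theorem theorem9 (N : network) (R : {set N}) (r : N) (h : N -> {set N} -> nat) :
  r \in R -> admissible R r h ->
  ds_terminates R r h /\
  (forall s : state N, ds_reachable R r h s -> ds_halted R r h s ->
     st_l s (r, R :\ r) = lstar r (R :\ r) /\ lstar r (R :\ r) = csmt R).
Proof.
move=> rR adm.
have reach_sound s : ds_reachable R r h s -> sound R r s.
  apply: ds_reachable_ind; last exact: sound_init_state.
  by move=> s1 s2; apply: ds_iteration_sound.
have rootE : lstar r (R :\ r) = csmt R by rewrite /lstar setD1K.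
have final s : ds_reachable R r h s -> ds_halted R r h s ->
    ((r, R :\ r) \in st_P s \/
     st_Q s = set0 /\ (R = [set r] \/ csmt R = total_cost N)) /\
    st_l s (r, R :\ r) <= csmt R.
  move=> reach halt; have ss := reach_sound s reach.
  have PQ : (r, R :\ r) \in st_P s \/ st_Q s = set0.
    have [|nP] := boolP ((r, R :\ r) \in st_P s); first by left.
    right; apply/eqP/negPn/negP => Q0.
    by have [s' /halt] := ds_iteration_total h rR ss nP Q0.
  (* In both degenerate cases the initial value of the root label is already optimal, and values
     never rise. *)
  have [R0|R0] := eqVneq (R :\ r) set0.
    split; first case: PQ; [by left | right; split=> // |].
      by left; rewrite -(setD1K rR) R0 setU0.
    by apply: leq_trans (sound_init ss _) _; rewrite /= R0 eqxx.
  have := csmt_le_total rR; rewrite leq_eqVlt => /predU1P[E|lt].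
    split; first by case: PQ; [left | right; split=> //; right].
    rewrite E; apply: leq_trans (sound_init ss _) _.
    by rewrite /=; do 2!case: ifP => // _.
  have inv : ds_invariant R r s.
    apply: ds_reachable_ind reach; last exact: ds_invariant_init.
    by move=> s1 s2; apply: ds_iteration_invariant.
  have rP : (r, R :\ r) \in st_P s.
    (* Otherwise an unsettled root label leaves a tight label in the queue, so the queue is not
       empty. *)
    case: PQ => // Q0; apply/negPn/negP => nP.
    by have [x] := queue_tight rR inv nP R0; rewrite Q0 inE.
  by split; [left | apply: inv_root rP].
split; last first.
  move=> s reach halt; split=> //; have [_ le] := final s reach halt.
  apply/eqP; rewrite eqn_leq rootE le -rootE.
  exact: (sound_lstar (reach_sound s reach) (r, R :\ r)).
split; first exact/ds_terminating/sound_init_state.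
move=> s reach halt; split; first by have [] := final s reach halt.
exact: (retrace_exists (r, R :\ r) (reach_sound s reach)).
Qed.
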